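(* Every realizable target pair $(H_w,H_r)$ satisfies exchange closure (EC), i.e. possesses an admissible EC witness.
   Context: Instances and realizability. An instance consists of a finite set $E$ of items with rational values $a_i\ge 0$, positive integer sizes $d_i$, and integer capacities $0\le R<D$, with $d_i\le D$ for every item. Write $G(S)=\sum_{i\in S}a_i$ and $d(S)=\sum_{i\in S}d_i$. For $\alpha\in\{w,r\}$ let $U^\alpha(n)$ be the maximum of $G(S)$ over $n$-element sets $S\subseteq E$ with $d(S)\le D$ (for $\alpha=w$) or $d(S)\le R$ (for $\alpha=r$), with value $-\infty$ if there is none; $U^\alpha(0)=0$. The terminal count is $b_\alpha=\min\operatorname{arg\,max}_n U^\alpha(n)$. The hull is the sequence on $\{0,\dots,b_\alpha\}$ obtained by evaluating at integers the upper concave hull of the points $(n,U^\alpha(n))$, $0\le n\le b_\alpha$. A target pair $(H_w,H_r)$ consists of strictly increasing concave rational sequences $H_\alpha$ on $\{0,\dots,b_\alpha\}$ with $H_\alpha(0)=0$ (the zero sequence $(0)$, with $b_\alpha=0$, is allowed). It is realizable if a single instance has terminal counts $b_w,b_r$ and hulls exactly $H_w$ and $H_r$. Notation. $h_n=H_w(n)-H_w(n-1)$, $\rho_m=H_r(m)-H_r(m-1)$, $\rho_1:=0$ if $b_r=0$; $\bar H_\alpha(k)=H_\alpha(\min\{k,b_\alpha\})$. A positive count $n\le b_\alpha$ is an $\alpha$-vertex if $n=b_\alpha$ or the slopes of $H_\alpha$ immediately before and after $n$ differ. Dominance means $H_r(k)\le\bar H_w(k)$ for $0\le k\le b_r$.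 Exchange closure (EC). The pair satisfies EC if dominance holds and there is an admissible witness, consisting of: for each $w$-vertex $n$, an $n$-element labeled set $X_n$ with rational values $x_{n,i}$, a long/short label for each member, and a downward-closed family $\mathcal F_n$ of subsets of $X_n$ (the declared $r$-feasible subsets) containing $\varnothing$ and whose singletons are precisely the short members; for each $r$-vertex $m$, an $m$-element set $Z_m$ with rational values $z_{m,j}$; for each such $(n,m)$, a subset $O_{n,m}\subseteq X_n$ with $O_{n,m}\in\mathcal F_n$ and a map $\pi_{n,m}:O_{n,m}\to Z_m$; such that: (EC1) $0\le x_{n,i}\le H_w(1)$, short values are at most $\rho_1$, $\sum_i x_{n,i}=H_w(n)$; every $S\subseteq X_n$ has total value at most $\bar H_w(|S|)$, and every $S\in\mathcal F_n$ has total value at most $\bar H_r(|S|)$. (EC2) $0\le z_{m,j}\le\rho_1$, $\sum_j z_{m,j}=H_r(m)$, and every $S\subseteq Z_m$ has total value at most $\bar H_r(|S|)$. (EC3) $\pi_{n,m}$ is injective, $O_{n,m}$ contains only short members, and $x_{n,i}=z_{m,\pi_{n,m}(i)}$ for $i\in O_{n,m}$. (EC4) For every $(n,m)$ and every long $i\in X_n$, with $k=|O_{n,m}|$, $\bar H_w(n-1+m-k)\ge H_w(n)-x_{n,i}+H_r(m)-\sum_{i'\in O_{n,m}}z_{m,\pi_{n,m}(i')}$. (EC5) For every $(n,m)$, every two-element subset $\{i,i'\}\subseteq X_n$ with $\{i,i'\}\notin\mathcal F_n$, and every $y\in X_n\setminus(\{i,i'\}\cup O_{n,m})$, $\bar H_w(m+1)\ge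 x_{n,y}+H_r(m)$. If $b_r=0$ there are no $r$-vertices and the conditions quantifying over $m$ are vacuous. *)

(* Defs.v *)
From HB Require Import structures.
From mathcomp Require Import all_boot all_order all_algebra.
From mathcomp Require Import constructive_ereal.

Set Implicit Arguments.
Unset Strict Implicit.
Unset Printing Implicit Defensive.
Import Order.TTheory GRing.Theory Num.Theory.
Local Open Scope ring_scope.

Record instance := Instance {
  item : finType;
  value : item -> rat;
  weight : item -> nat;
  capR : nat;
  capD : nat;
  value_ge0 : forall i, 0 <= value i;
  weight_gt0 : forall i, (0 < weight i)%N;
  weight_leD : forall i, (weight i <= capD)%N;
  capR_ltD : (capR < capD)%N
}.

Definition total_value (I : instance) (S : {set item I}) : rat :=
  \sum_(i in S) value i.

Definition total_weight (I : instance) (S : {set item I}) : nat :=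
  (\sum_(i in S) weight i)%N.

(* U^w is [optimum I (capD I)] and U^r is [optimum I (capR I)]; the empty
   maximum is -oo, and at n = 0 the only competitor is set0, so U(0) = 0. *)
Definition optimum (I : instance) (C n : nat) : \bar rat :=
  \big[Order.max/-oo%E]_(S : {set item I} |
      (#|S| == n) && (total_weight S <= C)%N) (total_value S)%:E.

Definition maximizer (U : nat -> \bar rat) (n : nat) : Prop :=
  forall k, (U k <= U n)%E.

Definition is_terminal_count (U : nat -> \bar rat) (b : nat) : Prop :=
  maximizer U b /\ forall n, maximizer U n -> (b <= n)%N.

Definition convex_weights (b n : nat) (l : 'I_b.+1 -> rat) : Prop :=
  [/\ forall k, 0 <= l k,
      \sum_k l k = 1 &
      \sum_k l k * (k : nat)%:R = n%:R].

(* H n is the largest ordinate over the abscissa n in the convex hull of the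
   points (k, U k), 0 <= k <= b.  Rational weights lose nothing: at an integer
   abscissa the maximum is attained on a segment joining two of the points,
   whose abscissas are integers.  A point with U k = -oo and weight 0
   contributes 0 * -oo = 0. *)
Definition is_hull (U : nat -> \bar rat) (b : nat) (H : nat -> rat) : Prop :=
  forall n, (n <= b)%N ->
    (exists2 l : 'I_b.+1 -> rat, convex_weights n l &
       (\sum_(k < b.+1) (l k)%:E * U k)%E = (H n)%:E) /\
    (forall l : 'I_b.+1 -> rat, convex_weights n l ->
       (\sum_(k < b.+1) (l k)%:E * U k <= (H n)%:E)%E).

(* A sequence on {0, ..., tcount}; [seqval] is unconstrained, and never used,
   beyond [tcount]. *)
Record target := Target {
  tcount : nat;
  seqval :> nat -> rat;
  target0 : seqval 0%N = 0;
  target_incr : forall n, (n < tcount)%N -> seqval n < seqval n.+1;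
  target_concave : forall n, (n.+1 < tcount)%N ->
    seqval n.+2 - seqval n.+1 <= seqval n.+1 - seqval n
}.

Definition realizable (Hw Hr : target) : Prop :=
  exists I : instance,
    [/\ is_terminal_count (optimum I (capD I)) (tcount Hw),
        is_terminal_count (optimum I (capR I)) (tcount Hr),
        is_hull (optimum I (capD I)) (tcount Hw) Hw &
        is_hull (optimum I (capR I)) (tcount Hr) Hr].

Definition slope (H : target) (n : nat) : rat := H n - H n.-1.

(* rho_1, with the convention for the zero sequence. *)
Definition slope1 (H : target) : rat :=
  if tcount H == 0%N then 0 else slope H 1.

Definition hbar (H : target) (k : nat) : rat := H (minn k (tcount H)).

Definition vertex (H : target) (n : nat) : bool :=
  (0 < n <= tcount H)%N && ((n == tcount H) || (slope H n != slope H n.+1)).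

Definition dominance (Hw Hr : target) : Prop :=
  forall k, (k <= tcount Hr)%N -> Hr k <= hbar Hw k.

(* X_n is identified with 'I_n; a member is short when it is not long. *)
Record wset (n : nat) := WSet {
  xval : 'I_n -> rat;
  long : pred 'I_n;
  rfeas : {set {set 'I_n}};
  rfeas0 : set0 \in rfeas;
  rfeas_down : forall S T : {set 'I_n}, T \subset S -> S \in rfeas ->
    T \in rfeas;
  rfeas1 : forall i : 'I_n, ([set i] \in rfeas) = ~~ long i
}.

(* The map pi_{n,m} is defined on the overlap O_{n,m} only. *)
Record overlap (n m : nat) := Overlap {
  ovset : {set 'I_n};
  ovmap : {i : 'I_n | i \in ovset} -> 'I_m
}.

(* The components at indices that are not vertices are irrelevant: [admissible]
   never looks at them, and they can always be filled in ([ovset] = set0). *)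
Record witness := Witness {
  wX : forall n, wset n;
  wZ : forall m, 'I_m -> rat;
  wO : forall n m, overlap n m
}.

Definition EC1 (Hw Hr : target) (n : nat) (X : wset n) : Prop :=
  [/\ forall i, 0 <= xval X i <= Hw 1%N,
      forall i, ~~ long X i -> xval X i <= slope1 Hr,
      \sum_i xval X i = Hw n,
      forall S : {set 'I_n}, \sum_(i in S) xval X i <= hbar Hw #|S| &
      forall S : {set 'I_n}, S \in rfeas X ->
        \sum_(i in S) xval X i <= hbar Hr #|S|].

Definition EC2 (Hr : target) (m : nat) (z : 'I_m -> rat) : Prop :=
  [/\ forall j, 0 <= z j <= slope1 Hr,
      \sum_j z j = Hr m &
      forall S : {set 'I_m}, \sum_(j in S) z j <= hbar Hr #|S|].

Definition EC3 (n m : nat) (X : wset n) (z : 'I_m -> rat)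
    (O : overlap n m) : Prop :=
  [/\ injective (ovmap (o := O)),
      forall i, i \in ovset O -> ~~ long X i &
      forall i : {i : 'I_n | i \in ovset O}, xval X (val i) = z (ovmap i)].

(* The natural-number subtraction never truncates: k <= m by injectivity. *)
Definition EC4 (Hw Hr : target) (n m : nat) (X : wset n) (z : 'I_m -> rat)
    (O : overlap n m) : Prop :=
  forall i, long X i ->
    hbar Hw (n - 1 + m - #|ovset O|)%N >=
      Hw n - xval X i + Hr m
        - \sum_(i' : {i : 'I_n | i \in ovset O}) z (ovmap i').

Definition EC5 (Hw Hr : target) (n m : nat) (X : wset n)
    (O : overlap n m) : Prop :=
  forall i i' : 'I_n, i != i' -> [set i; i'] \notin rfeas X ->
    forall y, y \notin [set i; i'] :|: ovset O ->
      hbar Hw m.+1 >= xval X y + Hr m.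

Definition admissible (Hw Hr : target) (W : witness) : Prop :=
  [/\ forall n, vertex Hw n -> EC1 Hw Hr (wX W n),
      forall m, vertex Hr m -> EC2 Hr (wZ W (m := m)) &
      forall n m, vertex Hw n -> vertex Hr m ->
        [/\ ovset (wO W n m) \in rfeas (wX W n),
            EC3 (wX W n) (wZ W (m := m)) (wO W n m),
            EC4 Hw Hr (wX W n) (wZ W (m := m)) (wO W n m) &
            EC5 Hw Hr (wX W n) (wO W n m)]].

Definition exchange_closure (Hw Hr : target) : Prop :=
  dominance Hw Hr /\ exists W : witness, admissible Hw Hr W.

(* Main.v *)
Require Import Defs.
From mathcomp Require Import all_boot all_order all_algebra.
From mathcomp Require Import constructive_ereal.
From mathcomp Require Import zify ring lra.

Set Implicit Arguments.
Unset Strict Implicit.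
Unset Printing Implicit Defensive.
Import Order.TTheory GRing.Theory Num.Theory.
Local Open Scope ring_scope.

(** The witness is read off an instance that realizes the pair.  A vertex of a
    hull is a point where the hull meets [optimum], because a line can be
    placed that touches the hull there and nowhere else
    ([vertex_supporting_line], [vertex_hullE]); so for each [w]-vertex [n] there
    is an [n]-element set [X] of weight at most [D] and value [Hw n], and for
    each [r]-vertex [m] an [m]-element set [Z] of weight at most [R] and value
    [Hr m].  Take these as the sets of the witness, call an item long when it
    is heavier than [R] and a set feasible when it weighs at most [R], and let
    the overlap of [X] and [Z] be their intersection.

    All the inequalities then come from one principle: a set of items that fits
    the capacity is worth at most the (extended) hull at its cardinality
    ([terminal_hull_bounds]).  Applied to subsets of [X] and of [Z] it gives EC1
    and EC2.  For EC4 it is applied to [X] with a long item replaced by all of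
    [Z]: this fits in [D] because more than [R] is released and at most [R]
    is added.  For EC5 it is applied to [Z] with one more item [y] of [X]: since
    [y] fits in [D] next to a pair heavier than [R], it fits in [D] next to [Z].
    Dominance holds because the hull is monotone in the data: the affine tangent
    of the concave sequence [hbar Hw] at [k] lies above all the points of
    which [Hr] is the hull ([hull_le_affine]). *)

(** * Concave sequences and their supporting lines *)

(** Successive differences decrease, so walking away from [n] in either
    direction the sequence gains no more than the slope at [n] predicts. *)
Lemma concave_le_tangent (g : nat -> rat) :
    (forall n, g n.+2 - g n.+1 <= g n.+1 - g n) ->
  forall n k, g k <= g n + (g n.+1 - g n) * (k%:R - n%:R).
Proof.
move=> g_concave n k.
have slope_anti a b : (a <= b)%N -> g b.+1 - g b <= g a.+1 - g a.
  elim: b => [|b IHb]; first by rewrite leqn0 => /eqP->.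
  rewrite leq_eqVlt => /predU1P[-> // | /IHb]; exact: le_trans.
have [le_nk | /ltnW le_kn] := leqP n k.
  elim: k le_nk => [|k IHk]; first by rewrite leqn0 => /eqP->; lra.
  rewrite leq_eqVlt => /predU1P[-> | le_nk]; first by lra.
  have := slope_anti n k le_nk; have := IHk le_nk.
  rewrite -(natr1 k); lra.
rewrite -(subKn le_kn); elim: (n - k)%N (leq_subr k n) => [|d IHd] le_dn.
  by rewrite subn0; lra.
have Ed : (n - d = (n - d.+1).+1)%N by lia.
have := slope_anti (n - d.+1)%N n (leq_subr _ _).
have := IHd (ltnW le_dn); rewrite Ed -(natr1 (n - d.+1)); lra.
Qed.

Lemma hbar_id (H : target) n : (n <= tcount H)%N -> hbar H n = H n.
Proof. by move=> le_nb; rewrite /hbar (minn_idPl le_nb). Qed.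

Lemma hbar_tcount (H : target) n : (tcount H <= n)%N -> hbar H n = H (tcount H).
Proof. by move=> le_bn; rewrite /hbar (minn_idPr le_bn). Qed.

Lemma hbar_le_tcount (H : target) n : hbar H n <= H (tcount H).
Proof.
have [/hbar_tcount-> // | lt_nb] := leqP (tcount H) n.
rewrite hbar_id 1?ltnW // -(subKn (ltnW lt_nb)).
elim: (tcount H - n)%N (leq_subr n (tcount H)) => [|d IHd] le_db.
  by rewrite subn0.
apply: le_trans (IHd (ltnW le_db)); rewrite ltW //.
have -> : (tcount H - d = (tcount H - d.+1).+1)%N by lia.
by apply: target_incr; lia.
Qed.

(** The extension by a constant keeps concavity, because the last slope of a
    strictly increasing sequence is positive. *)
Lemma hbar_concave (H : target) n :
  hbar H n.+2 - hbar H n.+1 <= hbar H n.+1 - hbar H n.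
Proof.
have [le_bn | ] := leqP (tcount H) n.+1.
  rewrite (hbar_tcount le_bn) (hbar_tcount (leqW le_bn)).
  by rewrite subrr subr_ge0 hbar_le_tcount.
move=> lt_nb; rewrite !hbar_id ?(ltnW lt_nb) ?(ltnW (ltnW lt_nb)) //.
exact: target_concave.
Qed.

(** The convention for the zero sequence is what makes the first slope the bound
    on the value of a single fitting item in every case. *)
Lemma slope1E (H : target) : slope1 H = hbar H 1.
Proof.
rewrite /slope1 /slope /hbar; case: eqP => [-> | /eqP].
  by rewrite minn0 target0.
by rewrite -lt0n => /minn_idPl->; rewrite target0 subr0.
Qed.

(** Passing to [hbar] treats both kinds of vertices alike: at the terminal count
    the slope drops from a positive number to 0. *)
Lemma vertex_slope_lt (H : target) n :
  vertex H n.+1 -> hbar H n.+2 - hbar H n.+1 < hbar H n.+1 - hbar H n.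
Proof.
case/andP=> /= lt_nb; have [lt_nb1 | le_bn _] := ltnP n.+1 (tcount H).
  rewrite ltn_eqF //= /slope /= => slope_neq.
  rewrite !hbar_id ?(ltnW lt_nb) // lt_neqAle eq_sym slope_neq.
  exact: target_concave.
have Eb : tcount H = n.+1 by apply/eqP; rewrite eqn_leq le_bn.
rewrite (hbar_tcount (leqW le_bn)) (hbar_tcount le_bn) subrr subr_gt0.
by rewrite hbar_id ?(ltnW lt_nb) // Eb target_incr.
Qed.

(** Any slope strictly between those before and after the vertex will do. *)
Lemma vertex_supporting_line (H : target) n : vertex H n ->
  exists s, forall k, k != n -> hbar H k < hbar H n + s * (k%:R - n%:R).
Proof.
case: n => [//|n] /vertex_slope_lt slope_lt.
have tangent := concave_le_tangent (@hbar_concave H).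
(* the mean of the two slopes adjacent to the vertex *)
exists ((hbar H n.+2 - hbar H n) / 2) => k.
have := tangent n k; have := tangent n.+1 k; rewrite -(natr1 n).
rewrite neq_ltn => ler lel /orP[lt_kn | lt_nk].
  have: k%:R - (n%:R + 1) < 0 :> rat by rewrite natr1 subr_lt0 ltr_nat.
  nra.
have: 0 < k%:R - (n%:R + 1) :> rat by rewrite natr1 subr_gt0 ltr_nat.
nra.
Qed.

(** * Hulls of extended-real sequences *)

(** The unit mass at [k] is among the competing weights. *)
Lemma hull_ge (U : nat -> \bar rat) b H k :
  is_hull U b H -> (k <= b)%N -> (U k <= (H k)%:E)%E.
Proof.
move=> hullH le_kb; have [_ /(_ (fun j => (j == inord k)%:R))] := hullH k le_kb.
rewrite (bigD1 (inord k)) //= eqxx mul1e inordK //.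
rewrite big1 ?adde0 => [|j /negPf->]; last by rewrite mul0e.
apply; split=> [j||]; first by rewrite ler0n.
  by rewrite (bigD1 (inord k)) //= eqxx big1 ?addr0 // => j /negPf->.
rewrite (bigD1 (inord k)) //= eqxx big1 ?addr0 => [|j /negPf->].
  by rewrite mul1r inordK.
by rewrite mul0r.
Qed.

(** The hull at [n] is a weighted mean of the points, and some weight is
    positive, so strict inequalities survive averaging. *)
Lemma hull_lt_affine (U : nat -> \bar rat) b H (a s : rat) n :
    is_hull U b H -> (n <= b)%N ->
    (forall k, (k <= b)%N -> (U k < (a + s * k%:R)%:E)%E) ->
  H n < a + s * n%:R.
Proof.
move=> hullH le_nb U_lt.
have [[l [l_ge0 l_sum1 l_mean] l_eq] _] := hullH n le_nb.
(* points at -oo are lifted to finite values still below the line *)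
pose u k := if U k is r%:E%E then r else a + s * k%:R - 1.
have Uu (k : 'I_b.+1) : ((l k)%:E * U k <= (l k * u k)%:E)%E.
  rewrite EFinM; apply: lee_wpmul2l; first by rewrite lee_fin.
  have := U_lt k (leq_ord k); rewrite /u.
  by case: (U k) => [r||] //; rewrite leNye.
have lt_u (k : 'I_b.+1) : u k < a + s * k%:R.
  have := U_lt k (leq_ord k); rewrite /u.
  by case: (U k) => [r||] //; rewrite ?lte_fin // => _; lra.
have /hasP[k _ lk_gt0] : has (fun k => 0 < l k) (enum 'I_b.+1).
  apply: contraT => /hasPn l_le0; have: (1 : rat) <= 0.
    rewrite -l_sum1; apply: sumr_le0 => k _.
    by rewrite leNgt l_le0 // mem_enum.
  by [].
have le_Hu : H n <= \sum_k l k * u k.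
  by rewrite -lee_fin -l_eq -sumEFin; apply: lee_sum => j _; apply: Uu.
apply: le_lt_trans le_Hu _.
have -> : a + s * n%:R = \sum_j l j * (a + s * (j : nat)%:R).
  under eq_bigr do rewrite mulrDr mulrCA.
  by rewrite big_split /= -mulr_suml -mulr_sumr l_sum1 l_mean mul1r.
rewrite [ltLHS](bigD1 k) //= [ltRHS](bigD1 k) //= ltr_leD ?ltr_pM2l //.
by apply: ler_sum => j _; rewrite ler_wpM2l // ltW.
Qed.

(** Raising the line by an arbitrary [e > 0] reduces this to the strict case. *)
Lemma hull_le_affine (U : nat -> \bar rat) b H (a s : rat) n :
    is_hull U b H -> (n <= b)%N ->
    (forall k, (k <= b)%N -> (U k <= (a + s * k%:R)%:E)%E) ->
  H n <= a + s * n%:R.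
Proof.
move=> hullH le_nb U_le; apply/ler_addgt0Pr => e e_gt0; rewrite addrAC ltW //.
apply: hull_lt_affine hullH le_nb _ => k /U_le /le_lt_trans; apply.
by rewrite lte_fin addrAC ltrDl.
Qed.

(** Otherwise [U] would lie strictly below a line supporting the hull at [n]
    only, and then so would the hull, contradicting that it meets the line
    at [n]. *)
Lemma vertex_hullE (U : nat -> \bar rat) (H : target) n :
  is_hull U (tcount H) H -> vertex H n -> U n = (H n)%:E.
Proof.
move=> hullH vn; have /andP[/andP[n_gt0 le_nb] _] := vn.
apply/eqP; rewrite eq_le (hull_ge hullH le_nb) leNgt; apply/negP => Un_lt.
have [s supp] := vertex_supporting_line vn.
suff: H n < (H n - s * n%:R) + s * n%:R by rewrite subrK ltxx.
apply: (hull_lt_affine hullH le_nb) => k le_kb.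
have [-> | /supp] := eqVneq k n; first by rewrite subrK.
rewrite !hbar_id // => lt_k; apply: le_lt_trans (hull_ge hullH le_kb) _.
by rewrite lte_fin; lra.
Qed.

(** * Fitting sets of items and optimal packings *)

Lemma optimum_ge (I : instance) C (S : {set item I}) :
  (total_weight S <= C)%N -> ((total_value S)%:E <= optimum I C #|S|)%E.
Proof.
move=> wS; apply: (le_bigmax_cond _ (fun T => (total_value T)%:E)).
by rewrite eqxx.
Qed.

Lemma optimum_attained (I : instance) C n r : optimum I C n = r%:E ->
  exists S : {set item I},
    [/\ #|S| = n, (total_weight S <= C)%N & total_value S = r].
Proof.
rewrite /optimum; apply: (big_ind (fun x => x = r%:E -> _)) => // [x y Kx Ky|].
  by rewrite maxElt; case: ifP.
by move=> S /andP[/eqP cardS wS] [valS]; exists S.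
Qed.

Definition hull_bounds (I : instance) C (H : target) : Prop :=
  forall S : {set item I},
    (total_weight S <= C)%N -> total_value S <= hbar H #|S|.

(** Beyond the terminal count the hull is extended by its last value, which is
    the global maximum of [optimum]. *)
Lemma terminal_hull_bounds (I : instance) C (H : target) :
    is_terminal_count (optimum I C) (tcount H) ->
    is_hull (optimum I C) (tcount H) H ->
  hull_bounds I C H.
Proof.
move=> [Umax _] hullH S wS; rewrite -lee_fin; apply: le_trans (optimum_ge wS) _.
have [le_Sb | /ltnW le_bS] := leqP #|S| (tcount H).
  by rewrite hbar_id // (hull_ge hullH).
by rewrite hbar_tcount // (le_trans (Umax _)) // (hull_ge hullH).
Qed.

Lemma sum_setUI (V : nmodType) (T : finType) (F : T -> V) (A B : {set T}) :
  \sum_(i in A :|: B) F i + \sum_(i in A :&: B) F i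
    = \sum_(i in A) F i + \sum_(i in B) F i.
Proof.
rewrite (big_setID A) setUK /= -addrA; congr (_ + _).
rewrite [RHS](big_setID A) /= setDUl setDv set0U addrC; congr (_ + _).
by rewrite setIC.
Qed.

(** An optimal set of [n] items, presented as an enumeration because the members
    of the [n]-th set of a witness are indexed by ['I_n]. *)
Definition packing (I : instance) C (H : nat -> rat) n
    (f : {ffun 'I_n -> item I}) :=
  [&& injectiveb f, total_weight (f @: [set: 'I_n]) <= C
    & total_value (f @: [set: 'I_n]) == H n]%N.

Lemma vertex_packing (I : instance) C (H : target) n :
    is_hull (optimum I C) (tcount H) H -> vertex H n ->
  exists f : {ffun 'I_n -> item I}, packing C H f.
Proof.
move=> hullH vn.
have [S [cardS wS vS]] := optimum_attained (vertex_hullE hullH vn).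
pose f := [ffun i : 'I_n => enum_val (cast_ord (esym cardS) i)].
have f_inj : injective f.
  by move=> i j; rewrite !ffunE => /enum_val_inj /cast_ord_inj.
have fS : f @: [set: 'I_n] = S.
  apply/eqP; rewrite eqEcard card_imset // cardsT card_ord cardS leqnn andbT.
  by apply/subsetP=> _ /imsetP[i _ ->]; rewrite ffunE enum_valP.
by exists f; rewrite /packing fS wS vS eqxx !andbT; apply/injectiveP.
Qed.

(** The option accounts for the counts at which [optimum] does not attain the
    hull, so that no packing exists. *)
Definition find_packing (I : instance) C (H : nat -> rat) n :=
  [pick f : {ffun 'I_n -> item I} | packing C H f].

Lemma find_packingP (I : instance) C (H : target) n :
    is_hull (optimum I C) (tcount H) H -> vertex H n ->
  exists2 f, find_packing I C H n = Some f & packing C H f.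
Proof.
move=> hullH /(vertex_packing hullH)[f0 f0P]; rewrite /find_packing.
by case: pickP => [f fP | /(_ f0)/idP//]; exists f.
Qed.

(** * The witness carried by an instance *)

Definition index_feasible (I : instance) n (f : {ffun 'I_n -> item I}) :=
  [set S : {set 'I_n} | (\sum_(i in S) weight (f i) <= capR I)%N].

Lemma index_feasible0 (I : instance) n (f : {ffun 'I_n -> item I}) :
  set0 \in index_feasible f.
Proof. by rewrite inE big_set0. Qed.

Lemma index_feasible_down (I : instance) n (f : {ffun 'I_n -> item I})
    (S T : {set 'I_n}) :
  T \subset S -> S \in index_feasible f -> T \in index_feasible f.
Proof.
move=> sTS; rewrite !inE; apply: leq_trans.
by rewrite [leqRHS](big_setID T) /= (setIidPr sTS) leq_addr.
Qed.

Lemma index_feasible1 (I : instance) n (f : {ffun 'I_n -> item I}) i :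
  ([set i] \in index_feasible f) = ~~ (capR I < weight (f i))%N.
Proof. by rewrite inE big_set1 leqNgt. Qed.

Definition packing_wset (I : instance) n (f : {ffun 'I_n -> item I}) : wset n :=
  WSet (fun i => value (f i)) (index_feasible0 f) (@index_feasible_down I n f)
    (index_feasible1 f).

Lemma trivial_family_down n (S T : {set 'I_n}) :
  T \subset S -> S \in [set set0] -> T \in [set set0].
Proof. by rewrite !inE => sTS /eqP S0; rewrite S0 subset0 in sTS. Qed.

Lemma trivial_family1 n (i : 'I_n) : ([set i] \in [set set0]) = ~~ true.
Proof. by rewrite inE; apply/negP => /eqP/setP/(_ i); rewrite !inE eqxx. Qed.

(** A family in which every member is long; it serves the counts without a
    packing, where the instance may even have no items to fill a set with. *)
Definition trivial_wset n : wset n :=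
  WSet (fun=> 0) (set11 set0) (@trivial_family_down n) (@trivial_family1 n).

Definition shared (I : instance) n m
    (f : {ffun 'I_n -> item I}) (g : {ffun 'I_m -> item I}) :=
  [set i | f i \in codom g].

Lemma shared_codom (I : instance) n m
    (f : {ffun 'I_n -> item I}) (g : {ffun 'I_m -> item I})
    (u : {i | i \in shared f g}) : f (val u) \in codom g.
Proof. by have := valP u; rewrite inE. Qed.

Definition packing_overlap (I : instance) n m
    (f : {ffun 'I_n -> item I}) (g : {ffun 'I_m -> item I}) : overlap n m :=
  Overlap (fun u : {i | i \in shared f g} => iinv (shared_codom u)).

Lemma overlap_map_set0 n m (u : {i : 'I_n | i \in set0}) : 'I_m.
Proof. by have := valP u; rewrite inE. Defined.

Definition trivial_overlap n m : overlap n m := Overlap (@overlap_map_set0 n m).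

Lemma total_value_imset (I : instance) n (f : {ffun 'I_n -> item I})
    (S : {set 'I_n}) : injective f ->
  total_value (f @: S) = \sum_(i in S) value (f i).
Proof. by move=> f_inj; rewrite /total_value big_imset //; apply: in2W. Qed.

Lemma total_weight_imset (I : instance) n (f : {ffun 'I_n -> item I})
    (S : {set 'I_n}) : injective f ->
  total_weight (f @: S) = (\sum_(i in S) weight (f i))%N.
Proof. by move=> f_inj; rewrite /total_weight big_imset //; apply: in2W. Qed.

Lemma total_weight_imset_le (I : instance) C n (f : {ffun 'I_n -> item I})
    (S : {set 'I_n}) :
  (total_weight (f @: [set: 'I_n]) <= C)%N -> (total_weight (f @: S) <= C)%N.
Proof.
apply: leq_trans; rewrite /total_weight [leqRHS](big_setID (f @: S)) /=.
by rewrite (setIidPr (imsetS _ (subsetT S))) leq_addr.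
Qed.

Lemma total_weight_setU (I : instance) (A B : {set item I}) :
  (total_weight (A :|: B) <= total_weight A + total_weight B)%N.
Proof. by rewrite -[leqRHS](sum_setUI (@weight I)) leq_addr. Qed.

(** * The exchange conditions *)

(** Stated for any capacity: it also gives most of EC1. *)
Lemma packing_EC2 (I : instance) C (H : target) m (g : {ffun 'I_m -> item I}) :
    hull_bounds I C H ->
    packing C H g ->
  EC2 H (fun j => value (g j)).
Proof.
move=> le_hbar /and3P[/injectiveP g_inj wg /eqP vg].
have sub_le (S : {set 'I_m}) : \sum_(j in S) value (g j) <= hbar H #|S|.
  rewrite -total_value_imset // -(card_imset _ g_inj) le_hbar //.
  exact: total_weight_imset_le.
split=> // [j|].
  by rewrite value_ge0 slope1E; have := sub_le [set j]; rewrite big_set1 cards1.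
by rewrite -vg total_value_imset //; apply: eq_bigl => j; rewrite inE.
Qed.

Lemma packing_EC1 (I : instance) (Hw Hr : target) n
    (f : {ffun 'I_n -> item I}) :
    hull_bounds I (capD I) Hw ->
    hull_bounds I (capR I) Hr ->
    (0 < tcount Hw)%N ->
    packing (capD I) Hw f ->
  EC1 Hw Hr (packing_wset f).
Proof.
move=> le_hbarw le_hbarr b_gt0 fP.
have [x_bnd x_sum x_sub] := packing_EC2 le_hbarw fP.
have /and3P[/injectiveP f_inj _ _] := fP.
have feas_le (S : {set 'I_n}) : S \in rfeas (packing_wset f) ->
    \sum_(i in S) value (f i) <= hbar Hr #|S|.
  rewrite inE -total_weight_imset // -total_value_imset // => wS.
  by rewrite -(card_imset _ f_inj) le_hbarr.
split=> // i; first by rewrite /= -(hbar_id b_gt0) -slope1E; apply: x_bnd.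
rewrite slope1E -(rfeas1 (packing_wset f)) => /feas_le.
by rewrite big_set1 cards1.
Qed.

Lemma sharedE (I : instance) n m
    (f : {ffun 'I_n -> item I}) (g : {ffun 'I_m -> item I}) :
  f @: shared f g = f @: [set: 'I_n] :&: g @: [set: 'I_m].
Proof.
apply/setP=> x; rewrite inE; apply/imsetP/andP=> [[i + ->] | []].
  rewrite inE => /codomP[j Eij]; split; first by rewrite imset_f ?inE.
  by rewrite Eij imset_f ?inE.
by case/imsetP=> i _ -> /imsetP[j _ Eij]; exists i; rewrite // inE Eij codom_f.
Qed.

Lemma shared_feasible (I : instance) (H : nat -> rat) n m
    (f : {ffun 'I_n -> item I}) (g : {ffun 'I_m -> item I}) :
    injective f -> packing (capR I) H g ->
  shared f g \in index_feasible f.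
Proof.
move=> f_inj /and3P[_ wg _]; rewrite inE -total_weight_imset // sharedE.
apply: leq_trans wg; rewrite /total_weight [leqRHS](big_setID (f @: setT)) /=.
by rewrite setIC leq_addr.
Qed.

Lemma packing_EC3 (I : instance) (H : nat -> rat) n m
    (f : {ffun 'I_n -> item I}) (g : {ffun 'I_m -> item I}) :
    injective f -> packing (capR I) H g ->
  EC3 (packing_wset f) (fun j => value (g j)) (packing_overlap f g).
Proof.
move=> f_inj gP; split=> [u v /= /(congr1 g) | i iO | u /=].
- by rewrite !f_iinv => /f_inj/val_inj.
- rewrite -(rfeas1 (packing_wset f)).
  apply: (@index_feasible_down _ _ f (shared f g)).
    by rewrite sub1set.
  exact: shared_feasible f_inj gP.
- by rewrite f_iinv.
Qed.

Lemma sum_overlap (I : instance) n m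
    (f : {ffun 'I_n -> item I}) (g : {ffun 'I_m -> item I}) : injective f ->
  \sum_(u : {i | i \in shared f g})
      value (g (ovmap (o := packing_overlap f g) u))
    = total_value (f @: shared f g).
Proof.
move=> f_inj; rewrite total_value_imset //.
rewrite (big_sub (shared f g) (fun i => value (f i))).
by apply: eq_bigr => u _; rewrite /= f_iinv.
Qed.

(** Replace the long item [i] of the first packing by the whole second packing.
    The items counted twice are the shared ones, and [i] is not among them since
    it does not fit in the smaller capacity. *)
Lemma packing_EC4 (I : instance) (Hw Hr : target) n m
    (f : {ffun 'I_n -> item I}) (g : {ffun 'I_m -> item I}) :
    hull_bounds I (capD I) Hw ->
    packing (capD I) Hw f -> packing (capR I) Hr g ->
  EC4 Hw Hr (packing_wset f) (fun j => value (g j)) (packing_overlap f g).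
Proof.
move=> le_hbar fP gP i /= long_i.
have /and3P[/injectiveP f_inj wf /eqP vf] := fP.
have /and3P[/injectiveP g_inj wg /eqP vg] := gP.
have iNO : i \notin shared f g.
  apply: contraL long_i => iO.
  by have [_ /(_ i iO) short _] := packing_EC3 f_inj gP.
rewrite sum_overlap //.
pose A := f @: [set~ i]; pose B := g @: [set: 'I_m].
have AB : A :&: B = f @: shared f g.
  apply/setP=> x; apply/idP/idP => [/setIP[/imsetP[j _ ->] fjB] | ].
    by rewrite sharedE inE imset_f ?inE.
  case/imsetP=> j jO ->; rewrite inE imset_f /=; last first.
    by rewrite !inE; apply: contraNneq iNO => <-.
  by have := imset_f f jO; rewrite sharedE => /setIP[].
have cardO : #|f @: shared f g| = #|shared f g| by apply: card_imset.
have cardAB : #|A :|: B| = (n - 1 + m - #|shared f g|)%N.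
  have := cardsUI A B; rewrite AB cardO.
  rewrite (card_imset _ f_inj) (card_imset _ g_inj) cardsC1 cardsT.
  by rewrite !card_ord; lia.
have vAB := sum_setUI (@value I) A B.
have vA : total_value A + value (f i) = Hw n.
  rewrite -vf !total_value_imset // addrC [RHS](bigD1 i) ?inE //=.
  by congr (_ + _); apply: eq_bigl => j; rewrite !inE.
have wA : (total_weight A + weight (f i) <= capD I)%N.
  apply: leq_trans wf; rewrite !total_weight_imset // addnC.
  rewrite [leqRHS](bigD1 i) ?inE //= leq_add2l eq_leq //.
  by apply: eq_bigl => j; rewrite !inE.
have : (total_weight (A :|: B) <= capD I)%N.
  apply: leq_trans (total_weight_setU A B) _.
  by apply: leq_trans wA; rewrite leq_add2l (leq_trans wg) // ltnW.
move/le_hbar; rewrite cardAB; apply: le_trans.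
by move: vAB; rewrite AB; rewrite /total_value in vA vg *; lra.
Qed.

(** The item [y] fits next to the pair, which is heavier than the whole second
    packing; so it can be added to that packing. *)
Lemma packing_EC5 (I : instance) (Hw Hr : target) n m
    (f : {ffun 'I_n -> item I}) (g : {ffun 'I_m -> item I}) :
    hull_bounds I (capD I) Hw ->
    packing (capD I) Hw f -> packing (capR I) Hr g ->
  EC5 Hw Hr (packing_wset f) (packing_overlap f g).
Proof.
move=> le_hbar /and3P[/injectiveP f_inj wf _] gP i i' neq_ii'.
have /and3P[/injectiveP g_inj wg /eqP vg] := gP.
rewrite inE -ltnNge big_setU1 ?inE //= big_set1 => w_pair y.
rewrite !inE !negb_or => /andP[/andP[neq_yi neq_yi'] fyNg].
pose B := g @: [set: 'I_m].
have fyNB : f y \notin B.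
  by apply: contra fyNg => /imsetP[j _ ->]; apply: codom_f.
have w_triple : (weight (f i) + weight (f i') + weight (f y) <= capD I)%N.
  apply: leq_trans wf; rewrite total_weight_imset //.
  rewrite (bigD1 i) ?inE //= (bigD1 i') ?inE 1?eq_sym //=.
  by rewrite (bigD1 y) ?inE ?neq_yi ?neq_yi' //= !addnA leq_addr.
have : (total_weight (f y |: B) <= capD I)%N.
  rewrite /total_weight big_setU1 //= addnC; apply: leq_trans w_triple.
  by rewrite leq_add2r (leq_trans wg) // ltnW.
move/le_hbar; rewrite cardsU1 fyNB (card_imset _ g_inj) cardsT card_ord.
by rewrite -vg {1}/total_value big_setU1.
Qed.

(** A set that fits the smaller capacity fits the larger one, so the tangent of
    [hbar Hw] at [k] dominates every point of the smaller problem. *)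
Lemma hull_bounds_dominance (I : instance) (Hw Hr : target) :
    hull_bounds I (capD I) Hw ->
    is_hull (optimum I (capR I)) (tcount Hr) Hr ->
  dominance Hw Hr.
Proof.
move=> le_hbar hullR k le_kb.
set s := hbar Hw k.+1 - hbar Hw k.
suff: Hr k <= (hbar Hw k - s * k%:R) + s * k%:R by rewrite subrK.
apply: (hull_le_affine hullR le_kb) => j _.
apply/bigmax_leP; split=> [|S /andP[/eqP cardS wS]]; first exact: leNye.
have wSD : (total_weight S <= capD I)%N.
  exact: leq_trans wS (ltnW (capR_ltD I)).
rewrite lee_fin; apply: le_trans (le_hbar S wSD) _.
have := concave_le_tangent (@hbar_concave Hw) k j.
by rewrite cardS -/s; lra.
Qed.

Definition packing_witness (I : instance) (Hw Hr : nat -> rat) : witness :=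
  Witness
    (fun n => if find_packing I (capD I) Hw n is Some f
              then packing_wset f else trivial_wset n)
    (fun m => if find_packing I (capR I) Hr m is Some g
              then fun j => value (g j) else fun=> 0)
    (fun n m => match find_packing I (capD I) Hw n,
                      find_packing I (capR I) Hr m with
                | Some f, Some g => packing_overlap f g
                | _, _ => trivial_overlap n m
                end).

Theorem theorem3p3 (Hw Hr : target) (Hreal : realizable Hw Hr) :
  exchange_closure Hw Hr.
Proof.
case: Hreal => I [termD termR hullD hullR].
have leD := terminal_hull_bounds termD hullD.
have leR := terminal_hull_bounds termR hullR.
split; first exact: hull_bounds_dominance leD hullR.
exists (packing_witness I Hw Hr); split=> [n vn | m vm | n m vn vm] /=.
- have [f -> fP] := find_packingP hullD vn.
  apply: packing_EC1 leD leR _ fP.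
  by case/andP: vn => /andP[n_gt0 /(leq_trans n_gt0)].
- have [g -> gP] := find_packingP hullR vm.
  exact: packing_EC2 leR gP.
have [f -> fP] := find_packingP hullD vn.
have [g -> gP] := find_packingP hullR vm.
have /and3P[/injectiveP f_inj _ _] := fP.
split.
- exact: shared_feasible f_inj gP.
- exact: packing_EC3 f_inj gP.
- exact: packing_EC4 leD fP gP.
- exact: packing_EC5 leD fP gP.
Qed.
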